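(* Consider the two-stage distributionally robust problem $w^*=\min_{\mathbf x\in\mathcal X} f_1(\mathbf x)+\sup_{P\in\mathcal P}E_P[Q(\mathbf x,\xi)]$ in which the recourse problem is feasible for every $\mathbf x\in\mathcal X$ and $\xi\in\Xi$, and the two algorithms ''basic C&CG'' and ''C&CG-DRO'' (with Oracle-2) defined in the context. (i) Assume that basic C&CG and C&CG-DRO have the same scenario set $\widehat{\boldsymbol\xi}^o$ before the start of iteration $t^0$. Assume further that the solution algorithms used for their master problems and subproblems are deterministic, and that the pricing master problem $\mathrm{PMP}(O)$ has a unique shadow price (optimal dual solution) with respect to $\widehat{\boldsymbol\xi}^o$. Then the lower bound derived from basic C&CG in iteration $t^0+1$ is dominated by (i.e. is less than or equal to) the lower bound derived from C&CG-DRO in iteration $t^0+1$. (ii) Assume that the main master problems of basic C&CG and of C&CG-DRO generate the same first-stage solution in iteration $t^0$. If the upper bound is updated in basic C&CG in iteration $t^0$, then this upper bound is dominated by (i.e. is greater than or equal to) the upper bound of C&CG-DRO.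
   Context: Setting. $\Xi\subseteq\mathbb R^{n_\xi}$ is closed and bounded, $\mathcal F$ is a $\sigma$-algebra on $\Xi$ containing all singletons, $\mathcal M(\Xi,\mathcal F)$ is the set of probability distributions. The ambiguity set is $\mathcal P=\{P\in\mathcal M(\Xi,\mathcal F):\int_\Xi P(d\xi)=1,\ \int_\Xi\psi_i(\xi)P(d\xi)\le\gamma_i\ \forall i\in[m]\}$, nonempty, with $\psi_i$ real-valued and continuous and $\gamma_i\in\mathbb R$. The recourse value is $Q(\mathbf x,\xi)=\min\{f_2(\mathbf x,\xi,\mathbf y):\mathbf y\in\mathcal Y(\mathbf x,\xi)\}$, assumed $>-\infty$ and upper semicontinuous in $\xi$; here $\mathcal Y(\mathbf x,\xi)\neq\emptyset$ for all $\mathbf x\in\mathcal X,\xi\in\Xi$. Main master problem (common to both algorithms), for a finite scenario set $\widehat{\boldsymbol\xi}^o\subseteq\Xi$: minimize $f_1(\mathbf x)+\eta$ subject to $\mathbf x\in\mathcal X$, $\eta\ge\alpha+\sum_{i=1}^m\gamma_i\beta_i$, $\alpha+\sum_{i=1}^m\psi_i(\xi)\beta_i\ge\eta_\xi$, $\eta_\xi=f_2(\mathbf x,\xi,\mathbf y_\xi)$, $\mathbf y_\xi\in\mathcal Y(\mathbf x,\xi)$ for all $\xi\in\widehat{\boldsymbol\xi}^o$, and $\beta_i\ge0$, $\alpha$ free. Its optimal value is the lower bound $LB$ of the iteration. Write $(\mathbf x^*,\alpha^*,\boldsymbol\beta^*,\dots)$ for the optimal solution obtained. Basic C&CG, one iteration: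 solve the main master problem; solve the subproblem $\alpha'=\max_{\xi\in\Xi}Q(\mathbf x^*,\xi)-\sum_i\psi_i(\xi)\beta_i^*$, with computed optimal solution $\xi'$; set $UB=\min\{UB,\ f_1(\mathbf x^* )+\alpha'+\sum_i\gamma_i\beta_i^*\}$; replace $\widehat{\boldsymbol\xi}^o$ by $\widehat{\boldsymbol\xi}^o\cup\{\xi'\}$. C&CG-DRO with Oracle-2, one iteration: solve the main master problem; run Oracle-2 for $\mathbf x^*$, initialized with the current $\widehat{\boldsymbol\xi}^o$, to obtain the optimal value $\eta^o(\mathbf x^* )$ of $\max_{P\in\mathcal P}E_P[Q(\mathbf x^*,\xi)]$ and the final scenario set $\hat{\boldsymbol\xi}^o(\mathbf x^* )\supseteq\widehat{\boldsymbol\xi}^o$; set $UB=\min\{UB,\ f_1(\mathbf x^* )+\eta^o(\mathbf x^* )\}$; replace $\widehat{\boldsymbol\xi}^o$ by $\hat{\boldsymbol\xi}^o(\mathbf x^* )$ (scenarios with zero probability are not removed). Oracle-2 (column generation) for fixed $\mathbf x^*$ and current finite set $\boldsymbol\xi^0\subseteq\Xi$: solve the linear program $\mathrm{PMP}(O)$: $\max\{\sum_{\xi\in\boldsymbol\xi^0}Q(\mathbf x^*,\xi)p_\xi:\sum_\xi p_\xi=1,\ \sum_\xi\psi_i(\xi)p_\xi\le\gamma_i\ \forall i,\ p_\xi\ge0\}$, with shadow price $(\bar\alpha,\bar{\boldsymbol\beta})$ ($\bar\alpha$ for the equality, $\bar\beta_i\ge 0$ for the inequalities); solve $\mathrm{PSP}(O)$: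 $v^*=\max_{\xi\in\Xi}Q(\mathbf x^*,\xi)-\bar\alpha-\sum_i\psi_i(\xi)\bar\beta_i$; if $v^*\le0$ stop, otherwise add the maximizer found to $\boldsymbol\xi^0$ and repeat. Oracle-2 is run until exact termination (tolerance $0$). ''Deterministic'' means that the same optimization problem (in particular, the same maximization over $\Xi$ up to an additive constant in the objective) always yields the same computed optimal solution. *)

(* Defs.v *)
From HB Require Import structures.
From mathcomp Require Import all_boot all_order all_algebra finmap.
From mathcomp Require Import all_classical all_reals all_analysis.
Import Order.TTheory GRing.Theory Num.Theory.
Import numFieldNormedType.Exports.

Set Implicit Arguments.
Unset Strict Implicit.
Unset Printing Implicit Defensive.

Local Open Scope classical_set_scope.
Local Open Scope ring_scope.

(* Data of a two-stage distributionally robust problem.  [pF] is a family of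
   subsets of [pXi]; the functions are total but matter only for first-stage
   decisions in [pX], scenarios in [pXi] and recourse decisions in [pY x xi]. *)
Record dro_problem (R : realType) (nx nxi ny m : nat) := DroProblem {
  pX : set 'rV[R]_nx ;
  pXi : set 'rV[R]_nxi ;
  pF : set (set 'rV[R]_nxi) ;
  pf1 : 'rV[R]_nx -> R ;
  pf2 : 'rV[R]_nx -> 'rV[R]_nxi -> 'rV[R]_ny -> R ;
  pY : 'rV[R]_nx -> 'rV[R]_nxi -> set 'rV[R]_ny ;
  ppsi : 'I_m -> 'rV[R]_nxi -> R ;
  pgamma : 'I_m -> R }.

(* A point of the main master problem.  The copies [ms_etas xi] and [ms_y xi]
   are meaningful only for the scenarios [xi] of the problem being solved. *)
Record master_sol (R : realType) (nx nxi ny m : nat) := MasterSol {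
  ms_x : 'rV[R]_nx ;
  ms_eta : R ;
  ms_alpha : R ;
  ms_beta : 'rV[R]_m ;
  ms_etas : 'rV[R]_nxi -> R ;
  ms_y : 'rV[R]_nxi -> 'rV[R]_ny }.

(* Contents of the memory of an algorithm between two iterations. *)
Record state (R : realType) (nxi : nat) := State {
  scen : {fset 'rV[R]_nxi} ;
  ub : \bar R }.

Section Definitions.
Context {R : realType} {nx nxi ny m : nat}.
Variable pb : dro_problem R nx nxi ny m.

Local Notation X := (pX pb).
Local Notation Xi := (pXi pb).
Local Notation f1 := (pf1 pb).
Local Notation f2 := (pf2 pb).
Local Notation Y := (pY pb).
Local Notation psi := (ppsi pb).
Local Notation gamma := (pgamma pb).
Local Notation decision := 'rV[R]_nx.
Local Notation scenario := 'rV[R]_nxi.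
Local Notation sol := (master_sol R nx nxi ny m).

(* [inf] is a junk value on sets that are empty or unbounded below;
   [recourse_feasible] and [recourse_finite] below exclude both cases.  The
   minimum is not required to be attained. *)
Definition recourse (x : decision) (xi : scenario) : R :=
  inf [set f2 x xi y | y in Y x xi].

(* [g_sigma_algebraType (pF pb)] carries the sigma-algebra on the whole of
   R^nxi generated by [pF pb]; its trace on [Xi] is [pF pb] itself
   (see [measurable_sub_Xi]), so that its probabilities giving mass 1 to [Xi]
   are exactly the probability distributions on ([Xi], [pF pb]).
   The integral of [psi i] is required to exist; since [psi i] is bounded on
   [Xi] this only asks for its measurability. *)
Definition ambiguity_set : set (probability (g_sigma_algebraType (pF pb)) R) :=
  [set P : probability (g_sigma_algebraType (pF pb)) R | P Xi = 1%E /\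
    forall i, integrable P Xi (EFin \o psi i) /\
              (\int[P]_(xi in Xi) (psi i xi)%:E <= (gamma i)%:E)%E].

Definition worst_case_expectation (x : decision) : \bar R :=
  ereal_sup [set (\int[P]_(xi in Xi) (recourse x xi)%:E)%E
            | P in ambiguity_set].

Record standing_assumptions : Prop := StandingAssumptions {
  Xi_closed : closed Xi ;
  Xi_bounded : bounded_set Xi ;
  F_sub : forall A, pF pb A -> A `<=` Xi ;
  F_sigma_algebra : sigma_algebra Xi (pF pb) ;
  F_singleton : forall xi, Xi xi -> pF pb [set xi] ;
  psi_continuous : forall i, {within Xi, continuous (psi i)} ;
  ambiguity_nonempty : ambiguity_set !=set0 ;
  recourse_feasible : forall x xi, X x -> Xi xi -> Y x xi !=set0 ;
  recourse_finite : forall x xi, X x -> Xi xi ->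
    has_lbound [set f2 x xi y | y in Y x xi] ;
  recourse_usc : forall x, X x ->
    lower_semicontinuous (fun xi : subspace Xi => (- recourse x xi)%:E) }.

Definition maximizer (g : scenario -> R) (xi : scenario) : Prop :=
  Xi xi /\ forall zeta, Xi zeta -> g zeta <= g xi.

Definition master_feasible (S : {fset scenario}) (z : sol) : Prop :=
  [/\ X (ms_x z),
      ms_alpha z + \sum_(i < m) gamma i * ms_beta z ord0 i <= ms_eta z,
      forall xi, xi \in S ->
        [/\ ms_etas z xi
              <= ms_alpha z + \sum_(i < m) psi i xi * ms_beta z ord0 i,
            ms_etas z xi = f2 (ms_x z) xi (ms_y z xi) &
            Y (ms_x z) xi (ms_y z xi)] &
      forall i, 0 <= ms_beta z ord0 i].

Definition master_value (z : sol) : R := f1 (ms_x z) + ms_eta z.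

Definition master_optimal (S : {fset scenario}) (z : sol) : Prop :=
  master_feasible S z /\
  forall z', master_feasible S z' -> master_value z <= master_value z'.

(* PMP(O) and its linear programming dual, for the decision [x]. *)
Definition pmp_feasible (S : {fset scenario}) (p : scenario -> R) : Prop :=
  [/\ \sum_(xi <- S) p xi = 1,
      forall i, \sum_(xi <- S) psi i xi * p xi <= gamma i &
      forall xi, xi \in S -> 0 <= p xi].

Definition pmp_value (x : decision) (S : {fset scenario})
    (p : scenario -> R) : R :=
  \sum_(xi <- S) recourse x xi * p xi.

Definition pmp_optimal (x : decision) (S : {fset scenario})
    (p : scenario -> R) : Prop :=
  pmp_feasible S p /\
  forall p', pmp_feasible S p' -> pmp_value x S p' <= pmp_value x S p.

Definition dual_feasible (x : decision) (S : {fset scenario})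
    (ab : R * 'rV[R]_m) : Prop :=
  (forall xi, xi \in S ->
     recourse x xi <= ab.1 + \sum_(i < m) psi i xi * ab.2 ord0 i) /\
  (forall i, 0 <= ab.2 ord0 i).

Definition dual_value (ab : R * 'rV[R]_m) : R :=
  ab.1 + \sum_(i < m) gamma i * ab.2 ord0 i.

Definition shadow_price (x : decision) (S : {fset scenario})
    (ab : R * 'rV[R]_m) : Prop :=
  dual_feasible x S ab /\
  forall ab', dual_feasible x S ab' -> dual_value ab <= dual_value ab'.

(* A solution algorithm is the relation between an optimization problem and
   the solutions it may compute for it: main master problems are given by
   their scenario set, maximizations over [Xi] by their objective. *)
Definition master_solver (M : {fset scenario} -> sol -> Prop) : Prop :=
  forall S z, M S z -> master_optimal S z.

Definition max_solver (A : (scenario -> R) -> scenario -> Prop) : Prop :=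
  forall g xi, A g xi -> maximizer g xi.

Definition deterministic_master (M : {fset scenario} -> sol -> Prop) : Prop :=
  forall S z z', M S z -> M S z' -> z = z'.

Definition deterministic_max (A : (scenario -> R) -> scenario -> Prop) : Prop :=
  forall (g h : scenario -> R) (c : R) xi zeta,
    (forall u, Xi u -> g u = h u + c) -> A g xi -> A h zeta -> xi = zeta.

Definition subproblem_obj (z : sol) (xi : scenario) : R :=
  recourse (ms_x z) xi - \sum_(i < m) psi i xi * ms_beta z ord0 i.

Definition psp_obj (x : decision) (ab : R * 'rV[R]_m) (xi : scenario) : R :=
  recourse x xi - ab.1 - \sum_(i < m) psi i xi * ab.2 ord0 i.

Definition basic_iteration (M : {fset scenario} -> sol -> Prop)
    (A : (scenario -> R) -> scenario -> Prop)
    (s : state R nxi) (z : sol) (s' : state R nxi) : Prop :=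
  M (scen s) z /\
  exists xi' : scenario,
    [/\ A (subproblem_obj z) xi',
        ub s' = Order.min (ub s)
          (f1 (ms_x z) + subproblem_obj z xi'
             + \sum_(i < m) gamma i * ms_beta z ord0 i)%:E &
        scen s' = (scen s `|` [fset xi'])%fset].

(* [oracle2 A x S S']: started from [S], Oracle-2 terminates with [S']. *)
Inductive oracle2 (A : (scenario -> R) -> scenario -> Prop) (x : decision) :
    {fset scenario} -> {fset scenario} -> Prop :=
| oracle2_stop S p ab xi :
    pmp_optimal x S p -> shadow_price x S ab -> A (psp_obj x ab) xi ->
    psp_obj x ab xi <= 0 -> oracle2 A x S S
| oracle2_add S p ab xi S' :
    pmp_optimal x S p -> shadow_price x S ab -> A (psp_obj x ab) xi ->
    0 < psp_obj x ab xi -> oracle2 A x (S `|` [fset xi])%fset S' ->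
    oracle2 A x S S'.

Definition dro_iteration (M : {fset scenario} -> sol -> Prop)
    (A : (scenario -> R) -> scenario -> Prop)
    (s : state R nxi) (z : sol) (s' : state R nxi) : Prop :=
  [/\ M (scen s) z,
      oracle2 A (ms_x z) (scen s) (scen s') &
      ub s' = Order.min (ub s)
        ((f1 (ms_x z))%:E + worst_case_expectation (ms_x z))%E].

(* [iterations it T s z]: the first [T] iterations of an algorithm with
   iteration [it]; [s t] is the state before iteration [t] (counted from 0) and
   [z t] the optimal solution of its main master problem.  The initial finite
   scenario set and upper bound are arbitrary. *)
Definition iterations (it : state R nxi -> sol -> state R nxi -> Prop)
    (T : nat) (s : nat -> state R nxi) (z : nat -> sol) : Prop :=
  (forall xi, xi \in scen (s 0%N) -> Xi xi) /\
  forall t, (t < T)%N -> it (s t) (z t) (s t.+1).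

Lemma measurable_sub_Xi (A : set scenario) :
  (forall B, pF pb B -> B `<=` Xi) -> sigma_algebra Xi (pF pb) ->
  A `<=` Xi ->
  measurable (A : set (g_sigma_algebraType (pF pb))) <-> pF pb A.
Proof.
move=> Fsub [F0 FC FU] AXi; split => [mA|FA]; last exact: sub_sigma_algebra.
suff : pF pb (A `&` Xi) by rewrite setIidl.
move: mA => /(_ [set B | pF pb (B `&` Xi)]); apply; split; last first.
  by move=> B FB /=; rewrite setIidl //; exact: Fsub.
split => /=.
- by rewrite set0I.
- move=> B /FC; rewrite setDE setCI setIUr setICr setU0.
  by rewrite setTD setIC.
- by move=> B FB; rewrite setI_bigcupl; exact: FU.
Qed.

End Definitions.

(* Main.v *)
Require Import Defs.
From HB Require Import structures.
From mathcomp Require Import all_boot all_order all_algebra finmap.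
From mathcomp Require Import all_classical all_reals all_analysis.
Import Order.TTheory GRing.Theory Num.Theory.
Local Open Scope classical_set_scope.
Local Open Scope ring_scope.

(** Part (i).  For a fixed first-stage decision [x], the constraints that the
    master problem puts on [(alpha, beta)] are, up to the attainment of the
    recourse minimum, those of the dual of PMP(O) on the same scenario set.
    Hence the pair [(alpha, beta)] of a master optimum is a shadow price for its
    decision ([master_optimal_shadow_price]), and uniqueness makes it the one
    that Oracle-2 uses in its first round.  The objective of the first pricing
    problem is then that of the subproblem of basic C&CG minus the constant
    [alpha], so that both algorithms compute the same scenario.  Either Oracle-2
    adds it, and the next master problem of C&CG-DRO has all the constraints of
    that of basic C&CG; or its price is nonpositive, in which case
    [(alpha, beta)] still satisfies the constraint of the new scenario: adding
    it to the master problem does not raise the optimal value, whereas C&CG-DRO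
    solves the same master problem again.

    Part (ii).  If [alpha'] is the value of the subproblem of basic C&CG, then
    [alpha' + \sum_i psi_i beta_i] is above the recourse value on the whole of
    Xi.  Integrating this against any distribution of the ambiguity set bounds
    its expected recourse by [alpha' + \sum_i gamma_i beta_i]
    ([worst_case_expectation_le], an instance of the weak duality
    [integral_le_moment_dual]), which is the second-stage part of the upper
    bound that basic C&CG computes. *)

(** * Monotonicity of the integral and weak duality *)

(** The recourse value need not be measurable for the sigma-algebra of the
    problem.  Monotonicity survives because the integral of a nonnegative
    function is a supremum over the simple functions below it. *)
Lemma ge0_le_integral_nonmeasurable d (T : measurableType d) (R : realType)
    (mu : {measure set T -> \bar R}) (D : set T) (f g : T -> \bar R) :
  (forall x, D x -> (0 <= f x)%E) -> (forall x, D x -> (f x <= g x)%E) ->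
  (\int[mu]_(x in D) f x <= \int[mu]_(x in D) g x)%E.
Proof.
move=> f0 fg.
have g0 x : D x -> (0 <= g x)%E by move=> Dx; apply: le_trans (f0 _ Dx) (fg _ Dx).
rewrite !ge0_integralE//; apply: ereal_sup_le => _ [h /= hf <-].
exists h => //= x; apply: le_trans (hf x) _.
by rewrite /patch; case: ifP => // /[!inE]; exact: fg.
Qed.

Lemma le_integral_nonmeasurable d (T : measurableType d) (R : realType)
    (mu : {measure set T -> \bar R}) (D : set T) (f g : T -> \bar R) :
  (forall x, D x -> (f x <= g x)%E) ->
  (\int[mu]_(x in D) f x <= \int[mu]_(x in D) g x)%E.
Proof.
move=> fg; have fgD : {in D, forall x, (f x <= g x)%E}.
  by move=> x /set_mem; exact: fg.
rewrite integralE [leRHS]integralE leeB//.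
- apply: ge0_le_integral_nonmeasurable => // x /mem_set; exact: funepos_le.
- apply: ge0_le_integral_nonmeasurable => // x /mem_set; exact: funeneg_le.
Qed.

(** Weak duality for the moment problem: [alpha] is the multiplier of the total
    mass and [beta i] that of the [i]-th moment constraint. *)
Lemma integral_le_moment_dual d (T : measurableType d) (R : realType)
    (P : probability T R) (D : set T) (m : nat) (psi : 'I_m -> T -> R)
    (gamma : 'I_m -> R) (q : T -> R) (alpha : R) (beta : 'I_m -> R) :
  measurable D -> P D = 1%E ->
  (forall i, P.-integrable D (EFin \o psi i)) ->
  (forall i, (\int[P]_(x in D) (psi i x)%:E <= (gamma i)%:E)%E) ->
  (forall i, 0 <= beta i) ->
  (forall x, D x -> q x <= alpha + \sum_(i < m) psi i x * beta i) ->
  (\int[P]_(x in D) (q x)%:E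
     <= (alpha + \sum_(i < m) gamma i * beta i)%:E)%E.
Proof.
move=> mD PD1 ipsi psi_le b0 q_le.
pose h i x := ((beta i)%:E * (psi i x)%:E)%E.
have ih i : P.-integrable D (h i) by apply: integrableZl => //; exact: ipsi.
pose c : T -> \bar R := cst alpha%:E.
have ic : P.-integrable D c by exact: finite_measure_integrable_cst.
apply: (@le_trans _ _ (\int[P]_(x in D) (c x + \sum_(i < m) h i x))%E).
  apply: le_integral_nonmeasurable => x Dx.
  rewrite /c /h /=; under eq_bigr do rewrite -EFinM mulrC.
  by rewrite sumEFin -EFinD lee_fin; exact: q_le.
rewrite integralD//; last exact: integrable_sum.
have -> : (\int[P]_(x in D) c x = alpha%:E)%E.
  by rewrite integral_cst// -[RHS]mule1; congr (_ * _)%E; exact: PD1.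
rewrite integral_sum// EFinD leeD2l//.
rewrite -sumEFin; apply: lee_sum => i _.
rewrite integralZl//; last exact: ipsi.
by rewrite mulrC EFinM lee_wpmul2l ?lee_fin//; exact: psi_le.
Qed.

Section DualityAndMaster.
Import numFieldNormedType.Exports.
Set Implicit Arguments.
Unset Strict Implicit.
Context {R : realType} {nx nxi ny m : nat}.
Variable pb : dro_problem R nx nxi ny m.
Hypothesis hpb : standing_assumptions pb.

Lemma measurable_Xi :
  measurable (pXi pb : set (g_sigma_algebraType (pF pb))).
Proof.
apply/(measurable_sub_Xi (F_sub hpb) (F_sigma_algebra hpb)) => //.
by have [F0 FC _] := F_sigma_algebra hpb; rewrite -[X in pF _ X]setD0; exact: FC.
Qed.

Lemma worst_case_expectation_le (x : 'rV[R]_nx) (ab : R * 'rV[R]_m) :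
  (forall i, 0 <= ab.2 ord0 i) ->
  (forall xi, pXi pb xi ->
     recourse pb x xi <= ab.1 + \sum_(i < m) ppsi pb i xi * ab.2 ord0 i) ->
  (worst_case_expectation pb x <= (dual_value pb ab)%:E)%E.
Proof.
move=> b0 qab; apply: ge_ereal_sup => _ [P [PXi psiP] <-].
apply: (@integral_le_moment_dual _ _ _ P (pXi pb) m (ppsi pb) (pgamma pb)
  (recourse pb x) ab.1 (fun i => ab.2 ord0 i)) => //.
- exact: measurable_Xi.
- by move=> i; have [] := psiP i.
- by move=> i; have [] := psiP i.
Qed.

(** * The master problem and the dual of the pricing master problem *)

Section FixedScenarios.
Variable S : {fset 'rV[R]_nxi}.
Hypothesis SXi : forall xi, xi \in S -> pXi pb xi.

Lemma master_feasible_dual_feasible (z : master_sol R nx nxi ny m) :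
  master_feasible pb S z ->
  dual_feasible pb (ms_x z) S (ms_alpha z, ms_beta z).
Proof.
move=> [Xz _ zS b0]; split=> //= xi xiS.
have [le_etas etasE Yz] := zS _ xiS.
apply: le_trans le_etas; rewrite etasE.
apply: ge_inf; last by exists (ms_y z xi).
exact: (recourse_finite hpb Xz (SXi xiS)).
Qed.

(** The recourse minimum need not be attained, so that a dual feasible point is
    only approximated by master points: raising its first coordinate by [eps]
    leaves room for an [eps]-optimal recourse decision in every scenario. *)
Lemma dual_feasible_master_approx (x : 'rV[R]_nx) (ab : R * 'rV[R]_m)
    (eps : R) :
  pX pb x -> dual_feasible pb x S ab -> 0 < eps ->
  exists2 z, master_feasible pb S z &
    master_value pb z = pf1 pb x + dual_value pb ab + eps.
Proof.
move=> Xx [qab b0] eps0.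
have /choice[y yP] (xi : 'rV[R]_nxi) : exists y, xi \in S ->
    pY pb x xi y /\ pf2 pb x xi y < recourse pb x xi + eps.
  have [xiS|] := boolP (xi \in S); last by exists 0.
  have inf_f2 : has_inf [set pf2 pb x xi y | y in pY pb x xi].
    split; last exact: (recourse_finite hpb Xx (SXi xiS)).
    have [y Yy] := recourse_feasible hpb Xx (SXi xiS).
    by exists (pf2 pb x xi y), y.
  by have [_ [y Yy <-] lt_y] := inf_adherent eps0 inf_f2; exists y.
exists (MasterSol x (dual_value pb ab + eps) (ab.1 + eps) ab.2
          (fun xi => pf2 pb x xi (y xi)) y); last first.
  by rewrite /master_value /= addrA.
split=> //=; first by rewrite /dual_value addrAC.
move=> xi xiS; have [Yy lt_y] := yP _ xiS; split=> //.
by rewrite addrAC (le_trans (ltW lt_y))// lerD2r qab.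
Qed.

Lemma master_optimal_le_dual_value (z : master_sol R nx nxi ny m)
    (x : 'rV[R]_nx) (ab : R * 'rV[R]_m) :
  master_optimal pb S z -> pX pb x -> dual_feasible pb x S ab ->
  master_value pb z <= pf1 pb x + dual_value pb ab.
Proof.
move=> [_ z_min] Xx abS; apply/ler_addgt0Pr => eps eps0.
have [z' z'S <-] := dual_feasible_master_approx Xx abS eps0.
exact: z_min.
Qed.

Lemma dual_value_le_master_value (z : master_sol R nx nxi ny m) :
  master_feasible pb S z ->
  pf1 pb (ms_x z) + dual_value pb (ms_alpha z, ms_beta z) <= master_value pb z.
Proof. by case=> _ etaz _ _; rewrite lerD2l. Qed.

Lemma master_optimal_shadow_price (z : master_sol R nx nxi ny m) :
  master_optimal pb S z ->
  shadow_price pb (ms_x z) S (ms_alpha z, ms_beta z).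
Proof.
move=> z_opt; have [zS _] := z_opt; have [Xz _ _ _] := zS.
split; first exact: master_feasible_dual_feasible.
move=> ab abS; rewrite -(lerD2l (pf1 pb (ms_x z))).
apply: le_trans (dual_value_le_master_value zS) _.
exact: master_optimal_le_dual_value.
Qed.

End FixedScenarios.

Lemma master_optimal_mono (S S' : {fset 'rV[R]_nxi})
    (z z' : master_sol R nx nxi ny m) :
  {subset S <= S'} -> master_optimal pb S z -> master_optimal pb S' z' ->
  master_value pb z <= master_value pb z'.
Proof.
move=> SS' [_ z_min] [[Xz' etaz' z'S' b0] _]; apply: z_min.
by split=> // xi /SS'; exact: z'S'.
Qed.

(** * Scenario sets of the algorithms *)

Section Algorithms.
Variables (M : {fset 'rV[R]_nxi} -> master_sol R nx nxi ny m -> Prop)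
  (A : ('rV[R]_nxi -> R) -> 'rV[R]_nxi -> Prop).
Hypothesis A_max : max_solver pb A.

Lemma basic_iterations_scen_Xi (T : nat) (s : nat -> state R nxi)
    (z : nat -> master_sol R nx nxi ny m) (t : nat) :
  iterations pb (basic_iteration pb M A) T s z -> (t <= T)%N ->
  forall xi, xi \in scen (s t) -> pXi pb xi.
Proof.
move=> [s0 step]; elim: t => // t IHt tT xi.
have [_ [xi' [/A_max[Xxi' _] _ ->]]] := step _ tT.
by rewrite in_fsetU in_fset1 => /orP[/(IHt (ltnW tT))//|/eqP ->].
Qed.

Lemma oracle2_scen_mono (x : 'rV[R]_nx) (S S' : {fset 'rV[R]_nxi}) :
  oracle2 pb A x S S' -> {subset S <= S'}.
Proof.
move=> ora; induction ora as [|S p ab xi S' _ _ _ _ _ IH] => // xi0 xi0S.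
by apply: IH; rewrite in_fsetU xi0S.
Qed.

(** The dichotomy on the first round of Oracle-2: since the shadow price is
    unique, this round prices scenarios by the objective of the subproblem
    shifted by [ms_alpha z], and computes the same scenario. *)
Lemma oracle2_first_round (S S' : {fset 'rV[R]_nxi})
    (z : master_sol R nx nxi ny m) (xi : 'rV[R]_nxi) :
  deterministic_max pb A -> (forall xi, xi \in S -> pXi pb xi) ->
  master_optimal pb S z ->
  (exists! ab : R * 'rV[R]_m, shadow_price pb (ms_x z) S ab) ->
  A (subproblem_obj pb z) xi -> oracle2 pb A (ms_x z) S S' ->
  xi \in S' \/ S' = S /\ subproblem_obj pb z xi <= ms_alpha z.
Proof.
move=> A_det SXi z_opt [ab0 [_ ab0_uniq]] Axi ora.
have price_eq ab zeta : shadow_price pb (ms_x z) S ab ->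
    A (psp_obj pb (ms_x z) ab) zeta ->
    zeta = xi /\ psp_obj pb (ms_x z) ab xi = subproblem_obj pb z xi - ms_alpha z.
  move=> /ab0_uniq <-.
  have /ab0_uniq -> := master_optimal_shadow_price SXi z_opt.
  have objE u : psp_obj pb (ms_x z) (ms_alpha z, ms_beta z) u =
      subproblem_obj pb z u + - ms_alpha z.
    by rewrite /psp_obj /subproblem_obj /= addrAC.
  by move=> Azeta; split; [exact: A_det Azeta Axi | exact: objE].
inversion ora as [S1 p ab zeta _ sp Azeta le0 E1 E2
                 |S1 p ab zeta S1' _ sp Azeta gt0 ora' E1 E2].
  have [ezeta eobj] := price_eq _ _ sp Azeta.
  by right; split=> //; rewrite -subr_le0 -eobj -ezeta.
have [<- _] := price_eq _ _ sp Azeta.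
by left; apply: (oracle2_scen_mono ora'); rewrite in_fsetU in_fset1 eqxx orbT.
Qed.

(** In the second case of the dichotomy of [oracle2_first_round], [z] remains
    dual feasible after the addition of [xi]. *)
Lemma basic_bound_le (S S' : {fset 'rV[R]_nxi})
    (z zb zd : master_sol R nx nxi ny m) (xi : 'rV[R]_nxi) :
  deterministic_max pb A -> (forall xi, xi \in S -> pXi pb xi) ->
  master_optimal pb S z ->
  (exists! ab : R * 'rV[R]_m, shadow_price pb (ms_x z) S ab) ->
  A (subproblem_obj pb z) xi -> oracle2 pb A (ms_x z) S S' ->
  master_optimal pb (S `|` [fset xi])%fset zb -> master_optimal pb S' zd ->
  master_value pb zb <= master_value pb zd.
Proof.
move=> A_det SXi z_opt sp_uniq Axi ora zb_opt zd_opt.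
have [xiS'|[ES' le_alpha]] :=
    oracle2_first_round A_det SXi z_opt sp_uniq Axi ora.
  apply: master_optimal_mono zb_opt zd_opt => u.
  by rewrite in_fsetU in_fset1 => /orP[/(oracle2_scen_mono ora)//|/eqP ->].
move: zd_opt; rewrite ES' => zd_opt.
have [Xxi _] := A_max Axi.
apply: (@le_trans _ _ (master_value pb z)); last first.
  exact: master_optimal_mono z_opt zd_opt.
have [zS _] := z_opt; have [Xz _ _ b0] := zS.
apply: le_trans (dual_value_le_master_value zS).
apply: master_optimal_le_dual_value zb_opt Xz _ => [u|].
  by rewrite in_fsetU in_fset1 => /orP[/SXi//|/eqP ->].
split=> //= u; rewrite in_fsetU in_fset1 => /orP[uS|/eqP ->].
  by have [/(_ _ uS)] := master_feasible_dual_feasible SXi zS.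
by rewrite -lerBlDr.
Qed.

End Algorithms.

(** * Upper bounds *)

Lemma worst_case_le_subproblem (S : {fset 'rV[R]_nxi})
    (z : master_sol R nx nxi ny m) (xi : 'rV[R]_nxi) :
  master_feasible pb S z -> maximizer pb (subproblem_obj pb z) xi ->
  (worst_case_expectation pb (ms_x z) <=
   (subproblem_obj pb z xi
      + \sum_(i < m) pgamma pb i * ms_beta z ord0 i)%:E)%E.
Proof.
move=> [_ _ _ b0] [_ xi_max].
apply: (@worst_case_expectation_le _ (subproblem_obj pb z xi, ms_beta z)) => //=.
by move=> u Xu; rewrite -lerBlDr; exact: xi_max.
Qed.

End DualityAndMaster.

Theorem proposition14 (R : realType) (nx nxi ny m : nat)
    (pb : dro_problem R nx nxi ny m) (hpb : standing_assumptions pb) :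
  (forall (M : {fset 'rV[R]_nxi} -> master_sol R nx nxi ny m -> Prop)
      (A : ('rV[R]_nxi -> R) -> 'rV[R]_nxi -> Prop)
      (sb sd : nat -> state R nxi) (zb zd : nat -> master_sol R nx nxi ny m)
      (t0 : nat),
    master_solver pb M -> max_solver pb A ->
    deterministic_master M -> deterministic_max pb A ->
    iterations pb (basic_iteration pb M A) t0.+1 sb zb ->
    iterations pb (dro_iteration pb M A) t0.+1 sd zd ->
    scen (sb t0) = scen (sd t0) ->
    (exists! ab : R * 'rV[R]_m,
       shadow_price pb (ms_x (zd t0)) (scen (sd t0)) ab) ->
    M (scen (sb t0.+1)) (zb t0.+1) ->
    M (scen (sd t0.+1)) (zd t0.+1) ->
    master_value pb (zb t0.+1) <= master_value pb (zd t0.+1))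
  /\
  (forall (Mb Md : {fset 'rV[R]_nxi} -> master_sol R nx nxi ny m -> Prop)
      (Ab Ad : ('rV[R]_nxi -> R) -> 'rV[R]_nxi -> Prop)
      (sb sd : nat -> state R nxi) (zb zd : nat -> master_sol R nx nxi ny m)
      (t0 : nat),
    master_solver pb Mb -> max_solver pb Ab ->
    master_solver pb Md -> max_solver pb Ad ->
    iterations pb (basic_iteration pb Mb Ab) t0.+1 sb zb ->
    iterations pb (dro_iteration pb Md Ad) t0.+1 sd zd ->
    ms_x (zb t0) = ms_x (zd t0) ->
    (ub (sb t0.+1) < ub (sb t0))%E ->
    (ub (sd t0.+1) <= ub (sb t0.+1))%E).
Proof.
split.
- move=> M A sb sd zb zd t0 M_opt A_max M_det A_det itb itd Es sp_uniq Mzb Mzd.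
  have SXi := basic_iterations_scen_Xi A_max itb (leqnSn t0).
  have [Mz [xi [Axi _ Eb]]] := itb.2 _ (ltnSn t0).
  have [Mz' ora _] := itd.2 _ (ltnSn t0).
  move: SXi Mz Eb; rewrite Es => SXi Mz Eb.
  have Ez := M_det _ _ _ Mz Mz'; rewrite Ez in Axi.
  apply: (basic_bound_le hpb A_max A_det SXi (M_opt _ _ Mz') sp_uniq Axi ora).
    by rewrite -Eb; exact: M_opt.
  exact: M_opt.
- move=> Mb Md Ab Ad sb sd zb zd t0 Mb_opt Ab_max _ _ itb itd Ex.
  have [Mz [xi [Axi -> _]]] := itb.2 _ (ltnSn t0).
  have [_ _ ->] := itd.2 _ (ltnSn t0).
  (* The bound of basic C&CG improves on the previous one only if the minimum
     is the value of the new candidate. *)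
  rewrite gt_min ltxx /= => lt_ub; rewrite (min_r (ltW lt_ub)) ge_min -Ex.
  apply/orP; right; rewrite -addrA EFinD leeD2l//.
  have [zS _] := Mb_opt _ _ Mz.
  exact: worst_case_le_subproblem zS (Ab_max _ _ Axi).
Qed.
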